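(* Let $R$ be a real closed field extension of $\mathbb{R}$, let $k\in\mathbb{Z}_{>0}$, and let $L\colon R\to R$ be a map. Then $L$ preserves all formulas in $\Gamma_k$ if and only if $L$ is unital, $\mathbb{R}$-linear, and $k$-positive. Respectively, $L$ preserves all formulas in $\Gamma=\bigcup_{k=1}^\infty\Gamma_k$ if and only if $L$ is unital, $\mathbb{R}$-linear, and completely positive.
   Context: $\Gamma_k$ is the set of all first-order formulas in the language of real closed fields with parameters from $\mathbb{R}$ that express a linear matrix inequality of size $k$ with coefficients from $\mathbb{R}$, i.e. a condition $A_0+x_1A_1+\cdots+x_nA_n\succeq0$ (positive semidefiniteness) in variables $x_1,\dots,x_n$, for some $n$ and some real symmetric $k\times k$ matrices $A_0,\dots,A_n$. A map $h\colon R\to R$ preserves a relation $K\subseteq R^n$ if $(h(a_1),\dots,h(a_n))\in K$ whenever $(a_1,\dots,a_n)\in K$; it preserves a formula if it preserves the relation defined by that formula over $R$. The map $h$ is unital if $h(1)=1$ (it preserves the formula $x=1$), and $\mathbb{R}$-linear if it preserves the formula $z=\lambda x+\mu y$ for all $\lambda,\mu\in\mathbb{R}$. $L\colon R\to R$ is $k$-positive if for every symmetric positive semidefinite $k\times k$ matrix $A=(a_{ij})$ with entries in $R$ the matrix $L(A):=(L(a_{ij}))_{i,j}$ is positive semidefinite. $L$ is completely positive if it is $k$-positive for every $k$. *)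

(* Defs.v *)
From HB Require Import structures.
From mathcomp Require Import all_boot all_order all_algebra.
From mathcomp Require Import ordered_qelim.
From mathcomp Require Import reals.

Set Implicit Arguments.
Unset Strict Implicit.
Unset Printing Implicit Defensive.

Import Order.TTheory GRing.Theory Num.Theory.

Local Open Scope ring_scope.

(* A real closed field extension of the reals F is a real closed field R with *)
(* a ring morphism iota : {rmorphism F -> R}. Such a morphism is injective,   *)
(* and it preserves the order because nonnegative elements of F are squares.  *)

Section Syntax.

Fixpoint term_vars (T : Type) (t : GRing.term T) : seq nat :=
  match t with
  | GRing.Var i => [:: i]
  | GRing.Const _ | GRing.NatConst _ => [::]
  | GRing.Add t1 t2 | GRing.Mul t1 t2 => term_vars t1 ++ term_vars t2
  | GRing.Opp t1 | GRing.NatMul t1 _ | GRing.Inv t1 | GRing.Exp t1 _ =>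
      term_vars t1
  end.

Fixpoint free_vars (T : Type) (f : ord.formula T) : seq nat :=
  match f with
  | ord.Bool _ => [::]
  | ord.Equal t1 t2 | ord.Lt t1 t2 | ord.Le t1 t2 =>
      term_vars t1 ++ term_vars t2
  | ord.Unit t1 => term_vars t1
  | ord.And f1 f2 | ord.Or f1 f2 | ord.Implies f1 f2 =>
      free_vars f1 ++ free_vars f2
  | ord.Not f1 => free_vars f1
  | ord.Exists i f1 | ord.Forall i f1 => [seq j <- free_vars f1 | j != i]
  end.

Fixpoint map_term (T U : Type) (h : T -> U) (t : GRing.term T) :
    GRing.term U :=
  match t with
  | GRing.Var i => GRing.Var U i
  | GRing.Const c => GRing.Const (h c)
  | GRing.NatConst m => GRing.NatConst U m
  | GRing.Add t1 t2 => GRing.Add (map_term h t1) (map_term h t2)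
  | GRing.Opp t1 => GRing.Opp (map_term h t1)
  | GRing.NatMul t1 m => GRing.NatMul (map_term h t1) m
  | GRing.Mul t1 t2 => GRing.Mul (map_term h t1) (map_term h t2)
  | GRing.Inv t1 => GRing.Inv (map_term h t1)
  | GRing.Exp t1 m => GRing.Exp (map_term h t1) m
  end.

Fixpoint map_formula (T U : Type) (h : T -> U) (f : ord.formula T) :
    ord.formula U :=
  match f with
  | ord.Bool b => ord.Bool b
  | ord.Equal t1 t2 => ord.Equal (map_term h t1) (map_term h t2)
  | ord.Lt t1 t2 => ord.Lt (map_term h t1) (map_term h t2)
  | ord.Le t1 t2 => ord.Le (map_term h t1) (map_term h t2)
  | ord.Unit t1 => ord.Unit (map_term h t1)
  | ord.And f1 f2 => ord.And (map_formula h f1) (map_formula h f2)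
  | ord.Or f1 f2 => ord.Or (map_formula h f1) (map_formula h f2)
  | ord.Implies f1 f2 => ord.Implies (map_formula h f1) (map_formula h f2)
  | ord.Not f1 => ord.Not (map_formula h f1)
  | ord.Exists i f1 => ord.Exists i (map_formula h f1)
  | ord.Forall i f1 => ord.Forall i (map_formula h f1)
  end.

End Syntax.

(* The variables x_1, ..., x_n are 'X_0, ..., 'X_(n-1). The test ord.rformula *)
(* excludes Inv and Unit, which are not in the language of ordered rings.     *)
Definition formula_in (F : realDomainType) (n : nat) (f : ord.formula F) : bool :=
  ord.rformula f && all (fun i => i < n)%N (free_vars f).

Definition defined_rel (F : Type) (S : realDomainType) (iota : F -> S)
    (n : nat) (f : ord.formula F) (a : n.-tuple S) : Prop :=
  ord.holds a (map_formula iota f).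

Definition psd (S : realDomainType) (k : nat) (A : 'M[S]_k) : Prop :=
  A^T = A /\ forall v : 'cV[S]_k, 0 <= (v^T *m A *m v) 0 0.

Definition lmi (F S : realDomainType) (iota : F -> S) (k n : nat)
    (A0 : 'M[F]_k) (A : 'I_n -> 'M[F]_k) (a : n.-tuple S) : Prop :=
  psd (map_mx iota A0 + \sum_(i < n) tnth a i *: map_mx iota (A i)).

(* f expresses the linear matrix inequality: the two are equivalent modulo    *)
(* the theory of real closed extensions of F. As that theory is complete,     *)
(* this amounts to equivalence in F itself.                                   *)
Definition expresses_lmi (F : realType) (k n : nat) (f : ord.formula F)
    (A0 : 'M[F]_k) (A : 'I_n -> 'M[F]_k) : Prop :=
  forall (S : rcfType) (iota : {rmorphism F -> S}) (a : n.-tuple S),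
    defined_rel iota f a <-> lmi iota A0 A a.

Definition Gamma (F : realType) (k n : nat) (f : ord.formula F) : Prop :=
  formula_in n f /\
  exists (A0 : 'M[F]_k) (A : 'I_n -> 'M[F]_k),
    [/\ A0^T = A0, forall i, (A i)^T = A i & expresses_lmi f A0 A].

Definition Gamma_all (F : realType) (n : nat) (f : ord.formula F) : Prop :=
  exists2 k : nat, (0 < k)%N & Gamma k n f.

Definition preserves_rel (S : Type) (n : nat) (h : S -> S)
    (K : n.-tuple S -> Prop) : Prop :=
  forall a : n.-tuple S, K a -> K (map_tuple h a).

Definition preserves (F : Type) (S : realDomainType) (iota : F -> S)
    (h : S -> S) (n : nat) (f : ord.formula F) : Prop :=
  preserves_rel h (@defined_rel F S iota n f).

Definition unital (S : realDomainType) (h : S -> S) : Prop := h 1 = 1.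

(* The formula is z = l * x + m * y with x, y, z the variables 0, 1, 2. *)
Definition real_linear (F : Type) (S : realDomainType) (iota : F -> S)
    (h : S -> S) : Prop :=
  forall l m : F, preserves iota h 3
    (ord.Equal (GRing.Var F 2)
       (GRing.Add (GRing.Mul (GRing.Const l) (GRing.Var F 0))
                  (GRing.Mul (GRing.Const m) (GRing.Var F 1)))).

Definition kpositive (S : realDomainType) (k : nat) (h : S -> S) : Prop :=
  forall A : 'M[S]_k, psd A -> psd (map_mx h A).

Definition completely_positive (S : realDomainType) (h : S -> S) : Prop :=
  forall k : nat, (0 < k)%N -> kpositive k h.

(* Main.v *)
Require Import Defs.
From mathcomp Require Import all_boot all_order all_algebra.
From mathcomp Require Import ordered_qelim.
From mathcomp Require Import reals.

Set Implicit Arguments.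
Unset Strict Implicit.
Unset Printing Implicit Defensive.

Import Order.TTheory GRing.Theory Num.Theory.

Local Open Scope ring_scope.

(** Every linear matrix inequality is expressed by the formula that quantifies
    universally over the entries of the test vector, so the statement is about
    preserving the relations [lmi iota A0 A]. If [L] is unital and real linear
    then it commutes with the affine pencil, and [k]-positivity finishes.
    Conversely, scalar affine inequalities are linear matrix inequalities
    supported on the (0,0) entry; equations [x = 1] and [z = l x + m y] are pairs
    of these. The cone of positive semidefinite matrices is itself a linear matrix
    inequality in the k * k entries, with the pencil symmetrized. *)

(** * Formulas for linear matrix inequalities: construction, evaluation, free variables *)

Definition sum_term {T : Type} (s : seq (GRing.term T)) : GRing.term T :=
  foldr (@GRing.Add T) (GRing.NatConst T 0) s.

Definition forall_vars {T : Type} (s : seq nat) (f : ord.formula T) :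
    ord.formula T :=
  foldr (@ord.Forall T) f s.

Definition pencil_term {T : Type} {k n : nat} (A0 : 'M[T]_k)
    (A : 'I_n -> 'M[T]_k) (i j : 'I_k) : GRing.term T :=
  GRing.Add (GRing.Const (A0 i j))
    (sum_term [seq GRing.Mul (GRing.Var T l) (GRing.Const (A l i j))
              | l : 'I_n <- enum 'I_n]).

(* The test vector is held by the variables n, ..., n + k - 1. *)
Definition pencil_form_term {T : Type} {k n : nat} (A0 : 'M[T]_k)
    (A : 'I_n -> 'M[T]_k) : GRing.term T :=
  sum_term [seq sum_term [seq GRing.Mul (GRing.Mul (GRing.Var T (n + i))
                                                   (pencil_term A0 A i j))
                                        (GRing.Var T (n + j))
                         | j : 'I_k <- enum 'I_k]
           | i : 'I_k <- enum 'I_k].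

Definition lmi_formula {T : Type} {k n : nat} (A0 : 'M[T]_k)
    (A : 'I_n -> 'M[T]_k) : ord.formula T :=
  forall_vars (seq.iota n k)
    (ord.Le (GRing.NatConst T 0) (pencil_form_term A0 A)).

Lemma map_sum_term (T U : Type) (h : T -> U) (s : seq (GRing.term T)) :
  map_term h (sum_term s) = sum_term (map (map_term h) s).
Proof. by elim: s => //= t s ->. Qed.

Lemma all_vars_sum_term (T : Type) (p : pred nat) (s : seq (GRing.term T)) :
  all p (term_vars (sum_term s)) = all (fun t => all p (term_vars t)) s.
Proof. by elim: s => //= t s IH; rewrite all_cat IH. Qed.

Lemma rterm_sum_term (R : unitRingType) (s : seq (GRing.term R)) :
  GRing.rterm (sum_term s) = all (@GRing.rterm R) s.
Proof. by elim: s => //= t s ->. Qed.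

Lemma eval_sum_term (R : unitRingType) (e : seq R) (I : finType)
    (t : I -> GRing.term R) :
  GRing.eval e (sum_term (map t (enum I))) = \sum_i GRing.eval e (t i).
Proof.
rewrite -big_enum /=; elim: (enum I) => [|i s IH]; first by rewrite big_nil.
by rewrite big_cons /= IH.
Qed.

Lemma map_forall_vars (T U : Type) (h : T -> U) (s : seq nat)
    (f : ord.formula T) :
  map_formula h (forall_vars s f) = forall_vars s (map_formula h f).
Proof. by elim: s => //= i s ->. Qed.

Lemma free_forall_vars (T : Type) (s : seq nat) (f : ord.formula T) :
  free_vars (forall_vars s f) = [seq j <- free_vars f | j \notin s].
Proof.
elim: s => [|i s IH] /=; first by rewrite filter_predT.
rewrite IH -filter_predI; apply: eq_filter => j /=.
by rewrite inE negb_or.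
Qed.

Lemma rformula_forall_vars (R : realDomainType) (s : seq nat)
    (f : ord.formula R) :
  ord.rformula (forall_vars s f) = ord.rformula f.
Proof. by elim: s. Qed.

(** With [size e = n], assigning variable [n] appends to the environment instead of overwriting or
    padding it, so the nested quantifiers build up an arbitrary extension [w] one entry at a
    time. *)
Lemma holds_forall_vars (R : realDomainType) (k n : nat) (f : ord.formula R)
    (e : seq R) : size e = n ->
  ord.holds e (forall_vars (seq.iota n k) f) <->
  forall w : seq R, size w = k -> ord.holds (e ++ w) f.
Proof.
elim: k n e => [|k IH] n e se /=.
  by split=> [He w /size0nil-> | /(_ [::] erefl)]; rewrite cats0.
have set_end x : set_nth 0 e n x = rcons e x.
  by rewrite -se; elim: (e) => //= y s ->.
have IHx x : ord.holds (set_nth 0 e n x) (forall_vars (seq.iota n.+1 k) f) <->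
    forall w, size w = k -> ord.holds (rcons e x ++ w) f.
  by rewrite set_end; apply: IH; rewrite size_rcons se.
split=> [He [|x w] //= [sw] | He x].
  by rewrite -cat_rcons; have /IHx := He x; apply.
by apply/IHx => w sw; rewrite cat_rcons; apply: He; rewrite /= sw.
Qed.

Lemma map_pencil_form_term (T U : Type) (h : T -> U) (k n : nat)
    (A0 : 'M[T]_k) (A : 'I_n -> 'M[T]_k) :
  map_term h (pencil_form_term A0 A) =
  pencil_form_term (map_mx h A0) (fun l => map_mx h (A l)).
Proof.
rewrite /pencil_form_term map_sum_term -map_comp; congr sum_term.
apply: eq_map => i /=; rewrite map_sum_term -map_comp; congr sum_term.
apply: eq_map => j /=; rewrite /pencil_term mxE map_sum_term -map_comp.
congr (GRing.Mul (GRing.Mul _ (GRing.Add _ (sum_term _))) _).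
by apply: eq_map => l /=; rewrite mxE.
Qed.

Lemma eval_pencil_form_term (S : realDomainType) (k n : nat)
    (A0 : 'M[S]_k) (A : 'I_n -> 'M[S]_k) (a : n.-tuple S) (v : 'cV[S]_k) :
  GRing.eval (a ++ [seq v i 0 | i <- enum 'I_k]) (pencil_form_term A0 A) =
  (v^T *m (A0 + \sum_(l < n) tnth a l *: A l) *m v) 0 0.
Proof.
set e := _ ++ _.
have eL (l : 'I_n) : nth 0 e l = tnth a l.
  by rewrite nth_cat size_tuple ltn_ord -tnth_nth.
have eR (i : 'I_k) : nth 0 e (n + i) = v i 0.
  rewrite nth_cat size_tuple ltnNge leq_addr /= addKn.
  by rewrite (nth_map i) ?size_enum_ord ?ltn_ord // nth_ord_enum.
rewrite eval_sum_term mxE.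
under [RHS]eq_bigr => j _ do rewrite mxE mulr_suml.
(* The term sums over rows outermost, the matrix product over columns outermost. *)
rewrite [RHS]exchange_big; apply: eq_bigr => i _ /=.
rewrite eval_sum_term; apply: eq_bigr => j _ /=.
rewrite !eR eval_sum_term !mxE summxE.
congr (_ * (_ + _) * _); apply: eq_bigr => l _ /=.
by rewrite eL mxE.
Qed.

(** All variables of the quadratic form lie below [n + k], and the quantifiers bind those from [n]
    on. *)
Lemma formula_in_lmi_formula (F : realDomainType) (k n : nat)
    (A0 : 'M[F]_k) (A : 'I_n -> 'M[F]_k) :
  formula_in n (lmi_formula A0 A).
Proof.
apply/andP; split.
  rewrite rformula_forall_vars /= rterm_sum_term all_map.
  apply/allP => i _ /=; rewrite rterm_sum_term all_map.
  apply/allP => j _ /=; rewrite rterm_sum_term !andbT.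
  by rewrite all_map; apply/allP.
rewrite free_forall_vars all_filter /=.
have: all (fun i => i < n + k)%N (term_vars (pencil_form_term A0 A)).
  rewrite all_vars_sum_term all_map; apply/allP => i _ /=.
  rewrite all_vars_sum_term all_map; apply/allP => j _ /=.
  rewrite all_cat /= !ltn_add2l !ltn_ord all_vars_sum_term !andbT.
  rewrite all_map; apply/allP => l _ /=.
  by rewrite andbT (leq_trans (ltn_ord l)) ?leq_addr.
apply: sub_all => i /= ink; rewrite mem_iota ink andbT -ltnNge.
by apply/implyP.
Qed.

Lemma pencil_sym (F S : realDomainType) (iota : {rmorphism F -> S}) (k n : nat)
    (A0 : 'M[F]_k) (A : 'I_n -> 'M[F]_k) (a : n.-tuple S) :
  A0^T = A0 -> (forall i, (A i)^T = A i) ->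
  let P := map_mx iota A0 + \sum_(i < n) tnth a i *: map_mx iota (A i) in
  P^T = P.
Proof.
move=> A0s As /=; rewrite linearD /= map_trmx A0s; congr (_ + _).
rewrite linear_sum /=; apply: eq_bigr => i _.
by rewrite linearZ /= map_trmx As.
Qed.

Lemma lmi_formula_expresses (F : realType) (k n : nat)
    (A0 : 'M[F]_k) (A : 'I_n -> 'M[F]_k) :
  A0^T = A0 -> (forall i, (A i)^T = A i) ->
  expresses_lmi (lmi_formula A0 A) A0 A.
Proof.
move=> A0s As S iota a; rewrite /defined_rel /lmi_formula map_forall_vars /=.
rewrite map_pencil_form_term.
split=> [/(holds_forall_vars _ _ (size_tuple a)) Hf | [_ Hp]].
  (* The formula speaks only of the quadratic form; the symmetry that [psd] also demands comes from
     the symmetric coefficients. *)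
  split=> [|v]; first exact: pencil_sym.
  rewrite -eval_pencil_form_term; apply: (Hf [seq v i 0 | i <- enum 'I_k]).
  by rewrite size_map size_enum_ord.
apply/(holds_forall_vars _ _ (size_tuple a)) => w sw /=.
have -> : w = [seq (\col_(i < k) nth 0 w i) i 0 | i <- enum 'I_k].
  apply: (@eq_from_nth _ 0); first by rewrite size_map size_enum_ord.
  move=> i; rewrite sw => lti.
  rewrite (nth_map (Ordinal lti)) ?size_enum_ord // mxE.
  by rewrite (nth_enum_ord _ lti).
by rewrite eval_pencil_form_term; apply: Hp.
Qed.

(** Preservation depends only on the relation a formula defines over [R]. This removes syntax from
    the rest of the argument. *)
Lemma preserves_Gamma_iff (F : realType) (R : rcfType)
    (iota : {rmorphism F -> R}) (k : nat) (L : R -> R) :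
  (forall (n : nat) (f : ord.formula F), Gamma k n f -> preserves iota L n f)
  <-> forall (n : nat) (A0 : 'M[F]_k) (A : 'I_n -> 'M[F]_k),
        A0^T = A0 -> (forall i, (A i)^T = A i) ->
        preserves_rel L (lmi iota A0 A).
Proof.
split=> [HL n A0 A A0s As a | HL n f [_ [A0 [A [A0s As fE]]]] a].
  have fE := lmi_formula_expresses A0s As.
  move=> /(fE R iota a) Ha; apply/(fE R iota).
  apply: HL Ha; split; first exact: formula_in_lmi_formula.
  by exists A0, A.
by move=> /(fE R iota a) Ha; apply/(fE R iota); apply: HL Ha.
Qed.

(** * Necessity: unitality, linearity and positivity from preserved matrix inequalities *)

Lemma psd_scale_delta (S : realDomainType) (k : nat) (x : S) :
  psd (x *: delta_mx 0 0 : 'M[S]_k.+1) <-> 0 <= x.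
Proof.
have form (v : 'cV[S]_k.+1) :
    (v^T *m (x *: delta_mx 0 0) *m v) 0 0 = x * v 0 0 ^+ 2.
  rewrite -scalemxAr -scalemxAl mxE; congr (_ * _).
  (* Factoring the matrix unit as a column times a row splits the form into two copies of the entry
     [v 0 0]. *)
  by rewrite -(mul_delta_mx (0 : 'I_1)) !mulmxA -colE -mulmxA -rowE !mxE
             big_ord1 !mxE.
split=> [[_ /(_ (delta_mx 0 0))] | x0].
  by rewrite form mxE !eqxx expr1n mulr1.
split=> [|v]; first by rewrite linearZ /= trmx_delta.
by rewrite form mulr_ge0 ?sqr_ge0.
Qed.

Section FromLMI.

Variables (F : realType) (R : rcfType) (iota : {rmorphism F -> R}).
Variables (k : nat) (L : R -> R).
Hypothesis L_lmi : forall (n : nat) (A0 : 'M[F]_k) (A : 'I_n -> 'M[F]_k),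
  A0^T = A0 -> (forall i, (A i)^T = A i) -> preserves_rel L (lmi iota A0 A).

(** Take all coefficients of the pencil to be multiples of one diagonal matrix unit; [0 < k]
    provides the entry that carries the inequality. *)
Lemma lmi_affine_ge0 (n : nat) (c : F) (b : 'I_n -> F) (a : n.-tuple R) :
  (0 < k)%N ->
  0 <= iota c + \sum_(i < n) tnth a i * iota (b i) ->
  0 <= iota c + \sum_(i < n) L (tnth a i) * iota (b i).
Proof.
case: k L_lmi => // k' HL _.
pose D := delta_mx 0 0 : 'M[F]_k'.+1.
have Ds x : (x *: D)^T = x *: D by rewrite linearZ /= trmx_delta.
have lmiE (a' : n.-tuple R) : lmi iota (c *: D) (fun i => b i *: D) a' <->
    0 <= iota c + \sum_(i < n) tnth a' i * iota (b i).
  rewrite -(psd_scale_delta k') /lmi map_mxZ map_delta_mx.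
  under eq_bigr => i _ do rewrite map_mxZ map_delta_mx scalerA.
  by rewrite -scaler_suml -scalerDl.
have := HL n (c *: D) (fun i => b i *: D) (Ds c) (fun i => Ds (b i)) a.
move=> + /lmiE Ha => /(_ Ha) /lmiE.
by under eq_bigr => i _ do rewrite tnth_map.
Qed.

(** Apply the affine case at the point 1 to [1 - x >= 0] and to [x - 1 >= 0]. *)
Lemma lmi_unital : (0 < k)%N -> unital L.
Proof.
move=> k0; apply/le_anti/andP; split; rewrite -subr_ge0.
  have := @lmi_affine_ge0 1 1 (fun=> - 1) [tuple 1] k0.
  by rewrite !big_ord1 /= !(tnth_nth 0) /= rmorphN rmorph1 !mulrN1 subrr; apply.
have := @lmi_affine_ge0 1 (- 1) (fun=> 1) [tuple 1] k0.
by rewrite !big_ord1 /= !(tnth_nth 0) /= rmorphN rmorph1 !mulr1 addNr addrC;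
  apply.
Qed.

Lemma lmi_real_linear : (0 < k)%N -> real_linear iota L.
Proof.
move=> k0 l m a; rewrite /defined_rel /=.
(* The signs [s = -1] and [s = 1] give the two inequalities whose conjunction is [z = l x + m y]. *)
have aff (s : F) (d : seq F) : d = [:: - (s * l); - (s * m); s] ->
    forall a' : 3.-tuple R,
    iota 0 + \sum_(i < 3) tnth a' i * iota (nth 0 d i) =
    iota s * (a'`_2 - (iota l * a'`_0 + iota m * a'`_1)).
  move=> -> a'; rewrite !big_ord_recl big_ord0 !(tnth_nth 0) /=.
  rewrite rmorph0 add0r addr0 !rmorphN !rmorphM mulrBr mulrDr opprD.
  by rewrite addrA addrC !mulrN !(mulrC a'`_0, mulrC a'`_1, mulrC a'`_2) !mulrA.
have mapE (d : seq F) : \sum_(i < 3) L (tnth a i) * iota (nth 0 d i) =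
    \sum_(i < 3) tnth (map_tuple L a) i * iota (nth 0 d i).
  by apply: eq_bigr => i _; rewrite tnth_map.
move=> aE; apply/eqP; rewrite -subr_eq0; apply/eqP/le_anti/andP; split.
  have := @lmi_affine_ge0 3 0 (fun i => nth 0 [:: - (-1 * l); - (-1 * m); -1] i)
    a k0.
  rewrite mapE !(aff _ _ erefl) aE subrr mulr0 rmorphN1 mulN1r oppr_ge0.
  by apply.
have := @lmi_affine_ge0 3 0 (fun i => nth 0 [:: - (1 * l); - (1 * m); 1] i)
  a k0.
by rewrite mapE !(aff _ _ erefl) aE subrr mulr0 rmorph1 mul1r; apply.
Qed.

Lemma lmi_kpositive : kpositive k L.
Proof.
(* Symmetrized matrix units: the pencil in the entries of [M] is [(M + M^T) / 2], which is [M]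
   itself for symmetric [M]. *)
pose E (i : 'I_(k * k)) : 'M[F]_k :=
  2^-1 *: (vec_mx (delta_mx 0 i) + (vec_mx (delta_mx 0 i))^T).
have Es i : (E i)^T = E i by rewrite linearZ linearD /= trmxK addrC.
have pencilE (M : 'M[R]_k) (a : (k * k).-tuple R) : M^T = M ->
    (forall i, tnth a i = mxvec M 0 i) ->
    map_mx iota 0 + \sum_i tnth a i *: map_mx iota (E i) = M.
  move=> Ms aE; rewrite map_mx0 add0r.
  have VE : \sum_i tnth a i *: vec_mx (delta_mx 0 i) = M.
    rewrite -[RHS]mxvecK [in RHS](row_sum_delta (mxvec M)) linear_sum /=.
    by apply: eq_bigr => i _; rewrite linearZ aE.
  under eq_bigr => i _.
    rewrite map_mxZ map_mxD -map_trmx map_vec_mx map_delta_mx fmorphV.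
    rewrite rmorph_nat scalerA mulrC -scalerA scalerDr.
    over.
  rewrite -scaler_sumr big_split /= VE.
  have -> : \sum_i tnth a i *: (vec_mx (delta_mx 0 i))^T = M^T.
    by rewrite -[in RHS]VE linear_sum /=; apply: eq_bigr => i _; rewrite linearZ.
  by rewrite Ms -mulr2n -scaler_nat scalerA mulVf ?pnatr_eq0 // scale1r.
move=> M psdM; have [Ms _] := psdM.
pose a := [tuple mxvec M 0 i | i < k * k].
have aE i : tnth a i = mxvec M 0 i by rewrite tnth_mktuple.
(* Entrywise application keeps symmetry, so [pencilE] also recovers [map_mx L M] from the image
   tuple. *)
have LMs : (map_mx L M)^T = map_mx L M by rewrite map_trmx Ms.
have LaE i : tnth (map_tuple L a) i = mxvec (map_mx L M) 0 i.
  by rewrite tnth_map aE -map_mxvec mxE.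
have := L_lmi (trmx0 _ _ _) Es (a := a).
by rewrite /lmi (pencilE M) // (pencilE (map_mx L M)) //; apply.
Qed.

End FromLMI.

(** * Sufficiency: unital, linear, positive maps preserve matrix inequalities *)

Section ToLMI.

Variables (F : realType) (R : rcfType) (iota : {rmorphism F -> R}).
Variables (L : R -> R).

Lemma real_linearE : real_linear iota L -> forall (l m : F) (x y : R),
  L (iota l * x + iota m * y) = iota l * L x + iota m * L y.
Proof.
move=> HL l m x y.
(* The third coordinate is chosen so that the equation holds by computation. *)
exact: (HL l m [tuple x; y; iota l * x + iota m * y] erefl).
Qed.

(** Each entry of the pencil is affine in [a] with coefficients from [F], and [L] fixes the image of
    [F]; hence [L] applied entrywise to the pencil at [a] is the pencil at the image of [a]. *)
Lemma positive_lmi (k n : nat) (A0 : 'M[F]_k) (A : 'I_n -> 'M[F]_k) :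
  unital L -> real_linear iota L -> kpositive k L ->
  preserves_rel L (lmi iota A0 A).
Proof.
move=> L1 /real_linearE Llin Lpos a /Lpos.
have LZ c x : L (iota c * x) = iota c * L x.
  by have := Llin c 0 x 0; rewrite rmorph0 !mul0r !addr0.
have LD x y : L (x + y) = L x + L y.
  by have := Llin 1 1 x y; rewrite rmorph1 !mul1r.
have L0 : L 0 = 0 by have := LZ 0 0; rewrite rmorph0 !mul0r.
have Lc c : L (iota c) = iota c by rewrite -[iota c]mulr1 LZ L1.
rewrite /lmi; congr psd; apply/matrixP => i j.
rewrite !mxE !summxE LD Lc (big_morph L LD L0); congr (_ + _).
by apply: eq_bigr => l _; rewrite tnth_map !mxE mulrC LZ mulrC.
Qed.

End ToLMI.

(** * The equivalences for a fixed size and for all sizes *)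

Lemma preserves_Gamma (F : realType) (R : rcfType) (iota : {rmorphism F -> R})
    (k : nat) (L : R -> R) : (0 < k)%N ->
  (forall (n : nat) (f : ord.formula F), Gamma k n f -> preserves iota L n f)
    <-> [/\ unital L, real_linear iota L & kpositive k L].
Proof.
move=> k0; rewrite preserves_Gamma_iff.
split=> [HL | [L1 Llin Lpos] n A0 A _ _].
  split; [exact: lmi_unital HL k0 | exact: lmi_real_linear HL k0 |].
  exact: lmi_kpositive HL.
exact: positive_lmi.
Qed.

Theorem lemma2p3 (F : realType) (R : rcfType) (iota : {rmorphism F -> R})
    (k : nat) (hk : (0 < k)%N) (L : R -> R) :
  ((forall (n : nat) (f : ord.formula F), Gamma k n f -> preserves iota L n f)
    <-> [/\ unital L, real_linear iota L & kpositive k L])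
  /\
  ((forall (n : nat) (f : ord.formula F), Gamma_all n f -> preserves iota L n f)
    <-> [/\ unital L, real_linear iota L & completely_positive L]).
Proof.
split; first exact: preserves_Gamma.
split=> [HL | [L1 Llin Lcp] n f [k' k'0 fk']].
  have Lk k' (k'0 : (0 < k')%N) :
      [/\ unital L, real_linear iota L & kpositive k' L].
    by apply/(preserves_Gamma _ _ k'0) => n f fk'; apply: HL; exists k'.
  (* Unitality and linearity do not mention the size, so size 1 already yields them. *)
  have [L1 Llin _] := Lk 1%N isT.
  by split=> // k' k'0; have [] := Lk k' k'0.
by move: n f fk'; apply/(preserves_Gamma _ _ k'0); split=> //; apply: Lcp.
Qed.
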